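(* Suppose that $(Y,X)$, with $Y=(Y_1,Y_2)$ and $X=(X_1,X_2)$, follows the two-period model $$Y_t=h_t(Y_t^* )=h_t(\alpha+X_t\beta-U_t),\qquad U_t\mid\alpha,X\sim F_t(u\mid\alpha,X),\qquad t=1,2,$$ and let the distribution of $(Y,X)$ be observed. Suppose that: (A1) for each $t$, the transformation $h_t:\mathcal{Y}^*\to\mathcal{Y}$ is unknown, non-decreasing, right continuous, and non-constant; (A2) (i) $F_1(u\mid\alpha,X)=F_2(u\mid\alpha,X)\equiv F(u\mid\alpha,X)$ for all $(\alpha,X)$; (ii) the support of $F(u\mid\alpha,X)$ is $\mathbb{R}$ for all $(\alpha,X)$; (A3) with $\Delta X=X_2-X_1$ and $W=(\Delta X,-1)$: (i) the distribution of $\Delta X$ is such that at least one component of $\Delta X$ has positive Lebesgue density on $\mathbb{R}$ conditional on all the other components of $\Delta X$ with probability one, and the corresponding component of $\beta$ is non-zero; (ii) the support of $W$ is not contained in any proper linear subspace of $\mathbb{R}^{K+1}$; (A4) for any $(y_1,y_2)\in\underline{\mathcal{Y}}^2$, $\theta(y_1,y_2)\equiv(\beta,\gamma(y_1,y_2))\in\Theta=\mathcal{B}\times\mathbb{R}$, where $\mathcal{B}=\{\beta:\beta\in\mathbb{R}^K,\ \|\beta\|=1\}$ and $\gamma(y_1,y_2)\equiv h_2^-(y_2)-h_1^-(y_1)$; (A5) for some $y_0\in\underline{\mathcal{Y}}$, $h_1^-(y_0)=0$. Then the transformations $h_1$ and $h_2$ are identified.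
   Context: Here $\alpha$ is an unobserved real random variable (fixed effect), $X_t$ is an observed random $1\times K$ row vector, $\beta\in\mathbb{R}^K$ is an unknown coefficient, $U_t$ is an unobserved error, and $F_t(u\mid\alpha,X)$ is its conditional distribution given $(\alpha,X)$. The supports of $Y_t$, $Y_t^*$ and $X_t$ are denoted $\mathcal{Y}\subseteq\mathbb{R}$, $\mathcal{Y}^*=\mathbb{R}$ and $\mathcal{X}\subseteq\mathbb{R}^K$, respectively (the supports may be indexed by $t$). Set $\underline{\mathcal{Y}}\equiv\mathcal{Y}\setminus\{\inf\mathcal{Y}\}$. The generalized inverse $h_t^-:\mathcal{Y}\to\mathcal{Y}^*$ of $h_t$ is $h_t^-(y)\equiv\inf\{y^*\in\mathcal{Y}^*: y\le h_t(y^* )\}$, with the convention $\inf(\emptyset)=\inf(\mathcal{Y})$. ''Identified'' has its usual meaning: any two structures (values of $\beta,h_1,h_2$ together with a joint distribution of $(\alpha,X,U_1,U_2)$) that satisfy the model and all the stated assumptions (the normalization (A5) being imposed at the same point $y_0$) and generate the same distribution of $(Y,X)$ give the same value of the object in question.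
   Formalization: In (A5) the set {y*: y_0 ≤ h_1(y* )} is additionally required to be nonempty; otherwise inf(∅)=inf(Y) can make (A5) hold vacuously (e.g. logistic cdf h_t, y_0=1) and h_t(·+c), α−c gives the same distribution, so the claim fails. *)

(* Defs.v *)
From HB Require Import structures.
From mathcomp Require Import all_boot all_order all_algebra.
From mathcomp Require Import all_classical all_reals all_analysis.
Set Implicit Arguments.
Unset Strict Implicit.
Unset Printing Implicit Defensive.
Import Order.TTheory GRing.Theory Num.Theory.
Import numFieldNormedType.Exports.
Local Open Scope classical_set_scope.
Local Open Scope ring_scope.

Definition support_of (T : topologicalType) (R : realType)
    (mu : set T -> \bar R) : set T :=
  [set x | forall O : set T, open O -> O x -> (0 < mu O)%E].

(* kappa is a regular version of the conditional distribution of V given W. *)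
Definition cond_dist (d dS dZ : measure_display) (T : measurableType d)
    (S : measurableType dS) (Z : measurableType dZ) (R : realType)
    (P : probability T R) (V : T -> S) (W : T -> Z) (kappa : R.-pker Z ~> S) :
    Prop :=
  forall (A : set S) (B : set Z), measurable A -> measurable B ->
    P (V @^-1` A `&` W @^-1` B) = (\int[P]_(w in W @^-1` B) kappa (W w) A)%E.

Definition euclidean_norm (R : realType) (K : nat) (b : 'cV[R]_K) : R :=
  Num.sqrt (\sum_(k < K) b k 0 ^+ 2).

(* A realization of (alpha, X, U), X = (X_1, X_2) and U = (U_1, U_2). Vectors of
   R^K are tuples here because tuples carry the product (i.e. Borel)
   sigma-algebra, which the library does not provide on matrices. *)
Notation latent R K := (R * 2.-tuple (K.-tuple R) * 2.-tuple R)%type.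

Notation period1 := (ord0 : 'I_2).
Notation period2 := (ord_max : 'I_2).

Record structure (R : realType) (K : nat) := Structure {
  beta : 'cV[R]_K ;
  h : 'I_2 -> R -> R ;
  law : probability (latent R K) R }.

Section Model.
Variables (R : realType) (K : nat).
Implicit Types (w : latent R K) (t : 'I_2) (y : R).

Definition alpha w : R := w.1.1.
Definition covariates w : 2.-tuple (K.-tuple R) := w.1.2.
Definition X t w : K.-tuple R := tnth (covariates w) t.
Definition U t w : R := tnth w.2 t.
Definition alphaX w : R * 2.-tuple (K.-tuple R) := (alpha w, covariates w).

Definition row_of (x : K.-tuple R) : 'rV[R]_K := \row_k tnth x k.

Definition DeltaX w : 'rV[R]_K := row_of (X period2 w) - row_of (X period1 w).
Definition W w : 'rV[R]_(K + 1) := row_mx (DeltaX w) (const_mx (-1)).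

Definition DeltaX_comp (k : 'I_K) w : R := DeltaX w 0 k.
Definition DeltaX_others (k : 'I_K) w : (K.-1).-tuple R :=
  [tuple DeltaX w 0 (lift k j) | j < K.-1].

Variable s : structure R K.

Definition Ystar t w : R :=
  alpha w + (row_of (X t w) *m beta s) 0 0 - U t w.
Definition Y t w : R := h s t (Ystar t w).

Definition observables w : 2.-tuple R * 2.-tuple (K.-tuple R) :=
  ([tuple Y t w | t < 2], covariates w).
Definition observed_dist : set (2.-tuple R * 2.-tuple (K.-tuple R)) -> \bar R :=
  pushforward (law s) observables.

Definition Ysupp t : set R := support_of (pushforward (law s) (Y t)).
Definition inf_Ysupp t : \bar R := ereal_inf (EFin @` Ysupp t).
Definition Yunder t : set R := [set y | Ysupp t y /\ y%:E != inf_Ysupp t].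

Definition upper_level t y : set R := [set ystar | y <= h s t ystar].

(* Extended-real valued: inf(Y_t) may be infinite. *)
Definition ginv t y : \bar R :=
  if pselect (upper_level t y !=set0)
  then ereal_inf (EFin @` upper_level t y) else inf_Ysupp t.

Definition gamma (y1 y2 : R) : \bar R := (ginv period2 y2 - ginv period1 y1)%E.
Definition theta (y1 y2 : R) : 'cV[R]_K * \bar R := (beta s, gamma y1 y2).

Definition calB : set 'cV[R]_K := [set b | euclidean_norm b = 1].
Definition Theta : set ('cV[R]_K * \bar R) :=
  calB `*` [set g | g \is a fin_num].

Definition A1 : Prop :=
  forall t, [/\ forall ystar, Ysupp t (h s t ystar),
    {homo h s t : x x' / x <= x'},
    right_continuous (h s t) &
    exists x x', h s t x != h s t x'].

(* Conditional distributions are defined up to null sets of (alpha, X), so a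
   condition "for all (alpha, X)" is a condition on some regular version. *)
Definition A2 : Prop :=
  exists F : 'I_2 -> R.-pker (R * 2.-tuple (K.-tuple R))%type ~> R,
  [/\ forall t, cond_dist (law s) (U t) alphaX (F t),
    forall (z : R * 2.-tuple (K.-tuple R)) (u : R),
      F period1 z `]-oo, u]%classic = F period2 z `]-oo, u]%classic &
    forall t z, support_of (F t z) = setT].

Definition A3_i : Prop :=
  exists k : 'I_K,
    (exists kappa : R.-pker (K.-1).-tuple R ~> R,
      cond_dist (law s) (DeltaX_comp k) (DeltaX_others k) kappa /\
      {ae law s, forall w, exists f : R -> R,
        [/\ measurable_fun setT f, forall x, 0 < f x &
          forall A : set R, measurable A ->
            kappa (DeltaX_others k w) A =
              (\int[lebesgue_measure]_(x in A) (f x)%:E)%E]}) /\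
    beta s k 0 != 0.

Definition A3_ii : Prop :=
  forall V : {vspace 'rV[R]_(K + 1)}, V != fullv ->
    ~ support_of (fun O => law s (W @^-1` O)) `<=` [set v | v \in V].

Definition A4 : Prop :=
  forall y1 y2, Yunder period1 y1 -> Yunder period2 y2 -> Theta (theta y1 y2).

(* The middle conjunct asks that the infimum defining h_1^-(y0) be over a
   nonempty set. If it were empty, h_1^-(y0) would be inf(Y) by convention, an
   equality h_1^-(y0) = 0 would not normalize the location of h_1, and
   (h_1, h_2, alpha) could be replaced by (h_1(. + c), h_2(. + c), alpha - c). *)
Definition A5 (y0 : R) : Prop :=
  [/\ Yunder period1 y0, upper_level period1 y0 !=set0 & ginv period1 y0 = 0%E].

Definition admissible (y0 : R) : Prop :=
  A1 /\ A2 /\ (A3_i /\ A3_ii) /\ A4 /\ A5 y0.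

End Model.

Definition identified (R : realType) (K : nat) (M : structure R K -> Prop)
    (V : Type) (feature : structure R K -> V) : Prop :=
  forall s s' : structure R K, M s -> M s' ->
    (forall A, measurable A -> observed_dist s A = observed_dist s' A) ->
    feature s = feature s'.

(* Main.v *)
Require Import Defs.
From mathcomp Require Import all_boot all_order all_algebra.
From mathcomp Require Import all_classical all_reals all_analysis.
From mathcomp Require Import measurable_realfun.
From mathcomp Require Import ring lra.

(* Let c_t be the generalized inverse of h_t at y_t, so that Y_t >= y_t iff
   U_t <= alpha + X_t beta - c_t. Since U_1 and U_2 have the same strictly
   increasing conditional cdf, on any set of covariates where
   Delta X beta > c_2 - c_1 (and which has positive probability) the event
   Y_2 >= y_2 is strictly more likely than Y_1 >= y_1, and conversely. Two
   observationally equivalent structures hence give Delta X beta - gamma and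
   Delta X beta' - gamma' opposite signs with probability zero. Two affine
   functions of the component of Delta X with positive density are never of
   opposite signs only if they are proportional, so W (b' theta - b theta') = 0
   almost surely, and (A3)(ii) with the norm of beta gives gamma = gamma'. The
   normalization at y_0 separates gamma into the two generalized inverses, from
   which h_1 and h_2 are recovered.

   Random thresholds are handled by inserting rational numbers, so that the
   conditional distributions are only evaluated on product sets. *)

Set Implicit Arguments.
Unset Strict Implicit.
Unset Printing Implicit Defensive.
Import Order.TTheory GRing.Theory Num.Theory.
Import numFieldNormedType.Exports.
Local Open Scope classical_set_scope.
Local Open Scope ring_scope.

(** * Measure-theoretic preliminaries: countable covers and positive integrals *)

Section CountableCovers.
Context d (T : measurableType d) (R : realType).
Variable mu : {measure set T -> \bar R}.

Lemma negligible_bigcup_countType (I : countType) (C : I -> set T) :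
  (forall i, mu.-negligible (C i)) -> mu.-negligible (\bigcup_i C i).
Proof.
move=> nC; apply: (negligibleS
  (A := \bigcup_n (if unpickle n is Some i then C i else set0))).
  by move=> x [i _ Cx]; exists (pickle i); rewrite ?pickleK.
apply: negligible_bigcup => n; case: unpickle => [i|].
  exact: nC.
exact: negligible_set0.
Qed.

(** Otherwise [A] would be a countable union of null sets. This selects, inside an event of positive
    probability, a piece on which fixed rationals separate random thresholds. *)
Lemma measure_cover_gt0 (I : countType) (A : set T) (C : I -> set T) :
  measurable A -> (forall i, measurable (C i)) -> A `<=` \bigcup_i C i ->
  (0 < mu A)%E -> exists i, (0 < mu (A `&` C i))%E.
Proof.
move=> mA mC AC; apply: contraPP => /forallNP no.
have null i : mu (A `&` C i) = 0%E.
  by apply/eqP; rewrite -[_ == _]negbK -measure_gt0; exact/negP/no.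
apply/negP; rewrite measure_gt0 negbK; apply/eqP/negligibleP => //.
apply: (negligibleS (B := A) (A := \bigcup_i (A `&` C i))).
  by move=> x Ax; have [i _ Cx] := AC _ Ax; exists i.
apply: negligible_bigcup_countType => i.
by apply/negligibleP; [exact: measurableI|exact: null].
Qed.

(** Making the cover disjoint splits [A] into pieces that each lie in one [C i], and countable
    additivity sums the comparisons. The hypothesis allows any measurable [D] inside [C i] because
    the disjoint pieces are smaller than the [C i]. *)
Lemma le_measure_cover dZ (Z : measurableType dZ) (V : T -> Z) (I : countType)
    (C : I -> set Z) (E1 E2 : set T) :
  measurable_fun setT V -> (forall i, measurable (C i)) ->
  measurable E1 -> measurable E2 ->
  (forall i D, measurable D -> D `<=` C i ->
    mu (E1 `&` V @^-1` D) <= mu (E2 `&` V @^-1` D))%E ->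
  forall A, measurable A -> A `<=` \bigcup_i C i ->
  (mu (E1 `&` V @^-1` A) <= mu (E2 `&` V @^-1` A))%E.
Proof.
move=> mV mC mE1 mE2 le12 A mA AC.
have mpre D : measurable D -> measurable (V @^-1` D).
  by move=> mD; rewrite -[X in measurable X]setTI; exact: mV.
pose F n := if unpickle n is Some i then A `&` C i else set0.
have mF n : measurable (F n).
  rewrite /F; case: unpickle => [i|]; first exact: measurableI.
  exact: measurable0.
pose G := seqDU F.
have mG n : measurable (G n) by exact: seqDU_measurable.
have AG : A = \bigcup_n G n.
  rewrite /G -seqDU_bigcup_eq; apply/seteqP; split=> [x Ax|x [n _]].
    have [i _ Cx] := AC _ Ax; exists (pickle i) => //.
    by rewrite /F pickleK.
  by rewrite /F; case: unpickle => // i [].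
have sumE E : measurable E -> mu (E `&` V @^-1` A) =
    (\sum_(0 <= n <oo | n \in [set: nat]) mu (E `&` V @^-1` (G n)))%E.
  move=> mE; rewrite AG preimage_bigcup setI_bigcupr measure_bigcup//.
    by move=> n _; apply: measurableI => //; exact: mpre.
  apply/trivIsetP => i j _ _ ij; rewrite setIACA -(preimage_setI V).
  have /trivIsetP/(_ _ _ Logic.I Logic.I ij) : trivIset setT G.
    exact: trivIset_seqDU.
  by move=> ->; rewrite preimage_set0 setI0.
rewrite !sumE//; apply: lee_nneseries => n _ //.
have := @subset_seqDU _ F n; rewrite -/(G n) /F.
case: unpickle => [i|] GF.
  by apply: (le12 i _ (mG n)) => x /GF[].
by rewrite (_ : G n = set0) ?preimage_set0 ?setI0//; apply/seteqP; split.
Qed.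

End CountableCovers.

(** A non-negative integrand with zero integral vanishes almost everywhere on [D]; together with
    almost sure positivity this makes [D] null. *)
Lemma integral_gt0 d (T : measurableType d) (R : realType)
    (mu : {measure set T -> \bar R}) (D : set T) (f : T -> \bar R) :
  measurable D -> measurable_fun D f -> (forall x, D x -> 0 <= f x)%E ->
  {ae mu, forall x, D x -> (0 < f x)%E} -> (0 < mu D)%E ->
  (0 < \int[mu]_(x in D) f x)%E.
Proof.
move=> mD mf f0 pos muD; rewrite lt0e integral_ge0// andbT.
apply/eqP => int0; move: muD; rewrite lt0e => /andP[/eqP muD0 _]; apply: muD0.
have : ae_eq mu D f (cst 0%E).
  apply/(ae_eq_integral_abs mu mD mf); rewrite -int0.
  by apply: eq_integral => x /set_mem Dx; rewrite gee0_abs// f0.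
move=> /(filterI pos) h0; apply/(negligibleP _ mD).
move: h0; rewrite /almost_everywhere; apply: negligibleS => x Dx /= [gt0 eq0].
by move: (gt0 Dx); rewrite eq0// ltxx.
Qed.

(** Serves twice: for the full support of the errors and for the positive density of a component of
    [DeltaX]. *)
Lemma cond_dist_gt0 d dS dZ (T : measurableType d) (S : measurableType dS)
    (Z : measurableType dZ) (R : realType) (P : probability T R) (V : T -> S)
    (V' : T -> Z) (kappa : R.-pker Z ~> S) (A : set S) (B : set Z) :
  measurable_fun setT V' -> cond_dist P V V' kappa ->
  measurable A -> measurable B ->
  {ae P, forall w, (0 < kappa (V' w) A)%E} -> (0 < P (V' @^-1` B))%E ->
  (0 < P (V @^-1` A `&` V' @^-1` B))%E.
Proof.
move=> mV' cd mA mB pos PB; rewrite cd//; apply: integral_gt0 => //.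
- by rewrite -[X in measurable X]setTI; exact: mV'.
- apply: measurable_funTS.
  exact: (measurableT_comp (measurable_kernel kappa A mA)).
- by apply: filterS pos => w.
Qed.

Lemma measurable_set_le d (T : measurableType d) (R : realType) (f g : T -> R) :
  measurable_fun setT f -> measurable_fun setT g ->
  measurable [set x | f x <= g x].
Proof.
move=> mf mg; rewrite -[X in measurable X]setTI.
by apply: (measurable_fun_ler mf mg) => //; exact: (measurable_set1 true).
Qed.

Lemma measurable_set_lt d (T : measurableType d) (R : realType) (f g : T -> R) :
  measurable_fun setT f -> measurable_fun setT g ->
  measurable [set x | f x < g x].
Proof.
move=> mf mg; rewrite -[X in measurable X]setTI.
by apply: (measurable_fun_ltr mf mg) => //; exact: (measurable_set1 true).
Qed.

(** * Threshold events for two errors with the same conditional cdf *)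

Section ConditionalComparison.
Context d dZ (T : measurableType d) (Z : measurableType dZ) (R : realType).
Variables (P : probability T R) (V : T -> Z) (U U' : T -> R).
Variables (kappa kappa' : R.-pker Z ~> R) (g g' : Z -> R).
Hypotheses (mV : measurable_fun setT V) (mU : measurable_fun setT U)
  (mU' : measurable_fun setT U') (mg : measurable_fun setT g)
  (mg' : measurable_fun setT g').
Hypotheses (cd : cond_dist P U V kappa) (cd' : cond_dist P U' V kappa').
Hypothesis eq_cdf : forall z u,
  kappa z `]-oo, u]%classic = kappa' z `]-oo, u]%classic.

Let mpreV D : measurable D -> measurable (V @^-1` D).
Proof. by move=> mD; rewrite -[X in measurable X]setTI; exact: mV. Qed.

Let E := [set w | U w <= g (V w)].
Let E' := [set w | U' w <= g' (V w)].

Let mE : measurable E.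
Proof. exact: measurable_set_le (measurableT_comp mg mV). Qed.

Let mE' : measurable E'.
Proof. exact: measurable_set_le (measurableT_comp mg' mV). Qed.

Let mI (u v : itv_bound R) (W : T -> R) :
  measurable_fun setT W -> measurable (W @^-1` [set` Interval u v]).
Proof.
by move=> mW; rewrite -[X in measurable X]setTI; apply: mW.
Qed.

Let eqP_level (q : R) D : measurable D ->
  P (U @^-1` `]-oo, q]%classic `&` V @^-1` D) =
  P (U' @^-1` `]-oo, q]%classic `&` V @^-1` D).
Proof.
move=> mD; rewrite cd// cd'//.
by apply: eq_integral => w _; exact: eq_cdf.
Qed.

Let le_level (q : R) D : measurable D -> (forall z, D z -> g z < q) ->
  (P (E `&` V @^-1` D) <= P (U @^-1` `]-oo, q]%classic `&` V @^-1` D))%E.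
Proof.
move=> mD Dq; apply: le_measure; rewrite ?inE.
- apply: measurableI => //; exact: mpreV.
- apply: measurableI; [exact: mI|exact: mpreV].
- move=> w [Ew Dw]; split=> //=; rewrite in_itv/= (le_trans Ew)// ltW//.
  exact: Dq.
Qed.

Let le_level' (q : R) D : measurable D -> (forall z, D z -> q < g' z) ->
  (P (U' @^-1` `]-oo, q]%classic `&` V @^-1` D) <= P (E' `&` V @^-1` D))%E.
Proof.
move=> mD Dq; apply: le_measure; rewrite ?inE.
- apply: measurableI; [exact: mI|exact: mpreV].
- apply: measurableI => //; exact: mpreV.
- move=> w [Ew Dw]; split=> //=; move: Ew; rewrite /E'/= in_itv/= => Ew.
  by rewrite (le_trans Ew)// ltW//; exact: Dq.
Qed.

(** Where [g < q < g'], the event [U <= g] implies [U <= q], which is as likely as [U' <= q], which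
    implies [U' <= g']. Such pieces with [q] rational cover [D]. *)
Lemma cond_dist_le_event D : measurable D -> D `<=` [set z | g z < g' z] ->
  (P (E `&` V @^-1` D) <= P (E' `&` V @^-1` D))%E.
Proof.
move=> mD Dgg'.
pose C (q : rat) := [set z | g z < ratr q] `&` [set z | ratr q < g' z].
apply: (@le_measure_cover _ _ _ P _ _ V rat C) => //.
- by move=> q; apply: measurableI; apply: measurable_set_lt.
- move=> q D' mD' D'C; apply: (le_trans (@le_level (ratr q) _ mD' _)).
    by move=> z /D'C[].
  by rewrite eqP_level//; apply: le_level' => // z /D'C[].
- move=> z /Dgg' /= /rat_in_itvoo[q]; rewrite in_itv/= => /andP[gq qg'].
  by exists q.
Qed.

Hypothesis kappa'_gt0 : forall z (q r : R),
  q < r -> (0 < kappa' z `]q, r]%classic)%E.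

(** Some rationals [q < r] lie between [g] and [g'] on a piece [D'] of positive probability, where
    [U'] falls between them with positive probability. On the rest of [D] the weak comparison
    suffices. *)
Lemma cond_dist_lt_event D : measurable D -> D `<=` [set z | g z < g' z] ->
  (0 < P (V @^-1` D))%E ->
  (P (E `&` V @^-1` D) < P (E' `&` V @^-1` D))%E.
Proof.
move=> mD Dgg' PD.
(* Pairs in the wrong order get the empty set, so that a piece of positive probability forces
   [q < r]. *)
pose C (i : rat * rat) := if i.1 < i.2 then
  [set z | g z < ratr i.1] `&` [set z | ratr i.2 < g' z] else set0.
have mC i : measurable (C i).
  by rewrite /C; case: ifP => // _; apply: measurableI; apply: measurable_set_lt.
have [||||[q r]] := @measure_cover_gt0 _ _ _ P _ (V @^-1` D)
    (fun i => V @^-1` (C i)).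
- exact: mpreV.
- by move=> i; exact: mpreV.
- move=> w /Dgg' /= /rat_in_itvoo[q]; rewrite in_itv/= => /andP[gq].
  move=> /rat_in_itvoo[r]; rewrite in_itv/= => /andP[qr rg'].
  by exists (q, r) => //; rewrite /C /= -(ltr_rat R) qr.
- by [].
rewrite -preimage_setI; set D' := D `&` C (q, r) => PD'.
have mD' : measurable D' by exact: measurableI.
have qr : q < r.
  apply/negPn/negP => /negbTE qr; move: PD'.
  by rewrite /D' /C /= qr setI0 preimage_set0 measure0 ltxx.
have D'q z : D' z -> g z < ratr q by rewrite /D' /C /= qr => -[_ []].
have D'r z : D' z -> ratr r < g' z by rewrite /D' /C /= qr => -[_ []].
have split_measure G : measurable G -> P (G `&` V @^-1` D) =
    (P (G `&` V @^-1` D') + P (G `&` V @^-1` (D `\` C (q, r))))%E.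
  move=> mG; rewrite -measureU.
  - rewrite -setIUr -preimage_setU; congr (P (_ `&` _ @^-1` _)).
    by rewrite setUIDK.
  - apply: measurableI => //; exact: mpreV.
  - by apply: measurableI => //; apply: mpreV; exact: measurableD.
  - by apply/seteqP; split=> // w [[_ [_ Cw]] [_ [_ nCw]]].
rewrite !split_measure//; apply: lte_leD.
- by rewrite fin_num_measure//; apply: measurableI => //; apply: mpreV;
    exact: measurableD.
- apply: (le_lt_trans (le_level mD' D'q)); rewrite eqP_level//.
  apply: (lt_le_trans _ (le_level' mD' D'r)).
  (* Cutting the half-line at [q] isolates the interval from [q] to [r], which supplies the strict
     gain. *)
  rewrite (_ : U' @^-1` `]-oo, ratr r]%classic `&` V @^-1` D' =
      (U' @^-1` `]-oo, ratr q]%classic `&` V @^-1` D') `|`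
      (U' @^-1` `]ratr q, ratr r]%classic `&` V @^-1` D')); last first.
    rewrite -setIUl -preimage_setU; congr (_ @^-1` _ `&` _).
    apply/seteqP; split=> x; rewrite /= !in_itv/=.
      by move=> ->; rewrite andbT; case: (leP x (ratr q)); [left|right].
    by case=> [/le_trans->//|/andP[]//]; rewrite ler_rat ltW.
  rewrite measureU; last 3 first.
  - apply: measurableI; [exact: mI|exact: mpreV].
  - apply: measurableI; [exact: mI|exact: mpreV].
  - apply/seteqP; split=> // w [[/= + _] [+ _]]; rewrite !in_itv/=.
    by move=> /le_lt_trans h /andP[/h]; rewrite ltxx.
  rewrite lteDl; last first.
    by rewrite fin_num_measure//; apply: measurableI; [exact: mI|exact: mpreV].
  apply: (cond_dist_gt0 mV cd') => //.
  by apply: aeW => w; apply: kappa'_gt0; rewrite ltr_rat.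
- apply: cond_dist_le_event; first exact: measurableD.
  by move=> z [/Dgg'].
Qed.

End ConditionalComparison.

Lemma support_itv_gt0 (R : realType) (mu : {measure set R -> \bar R}) (q r : R) :
  support_of mu = setT -> q < r -> (0 < mu `]q, r]%classic)%E.
Proof.
move=> supp qr; have : support_of mu ((q + r) / 2) by rewrite supp.
move=> /(_ `]q, r[%classic (itv_open _ _)).
rewrite /= in_itv/= !midf_lt// => /(_ isT) /lt_le_trans; apply.
apply: le_measure; rewrite ?inE//; apply: subset_itvl.
by rewrite bnd_simp.
Qed.

(** * Cutoffs of the transformations and observable events *)

Section Model.
Variables (R : realType) (K : nat).
Implicit Types (s : structure R K) (t : 'I_2) (y : R).

(** A function of the covariates alone, so that sign events are observable and have the same
    probability under both structures. *)
Definition lin_index t (b : 'cV[R]_K) (x : 2.-tuple (K.-tuple R)) : R :=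
  (row_of (tnth x t) *m b) 0 0.

Lemma measurable_lin_index t b : measurable_fun setT (lin_index t b).
Proof.
rewrite (_ : lin_index t b = fun x => \sum_k tnth (tnth x t) k * b k 0).
  apply: measurable_sum => k; apply: measurable_funM => //.
  exact: (measurableT_comp (measurable_tnth k) (measurable_tnth t)).
apply/funext => x; rewrite /lin_index mxE.
by apply: eq_bigr => k _; rewrite mxE.
Qed.

Lemma measurable_alphaX : measurable_fun setT (@alphaX R K).
Proof.
rewrite (_ : @alphaX R K = fst); first exact: measurable_fst.
by apply/funext => -[[]].
Qed.

Lemma measurable_covariates : measurable_fun setT (@covariates R K).
Proof. exact: (measurableT_comp measurable_snd measurable_fst). Qed.

Lemma measurable_U t : measurable_fun setT (@U R K t).
Proof. exact: (measurableT_comp (measurable_tnth t) measurable_snd). Qed.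

(** The Galois form of a real-valued generalized inverse, as a boolean equality that rewrites the
    event [y <= Y s t w] into an event on the error. *)
Definition is_cutoff s t y (c : R) := forall x, (y <= h s t x) = (c <= x).

Lemma cutoff_event s t y c w : is_cutoff s t y c ->
  (y <= Y s t w) = (U t w <= alpha w + lin_index t (beta s) (covariates w) - c).
Proof. by move=> cut; rewrite /Y cut /Ystar lerBrDr addrC -lerBrDr. Qed.

(** Monotonicity makes the upper level set closed upwards and right continuity makes its infimum
    attained. Nonemptiness excludes the convention for the infimum of the empty set. *)
Lemma ginv_cutoff s t y c : A1 s -> upper_level s t y !=set0 ->
  ginv s t y = c%:E -> is_cutoff s t y c.
Proof.
move=> /(_ t)[_ hmono hrc _] ne; rewrite /ginv; case: pselect => //= ? infE x.
apply/idP/idP => [yx|cx].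
  by rewrite -lee_fin -infE; apply: ereal_inf_lbound; exists x.
apply: le_trans (hmono _ _ cx); rewrite leNgt; apply/negP => hcy.
(* If [h s t c < y], the inequality persists just to the right of [c], where the infimum
   nevertheless requires a point of the upper level set. *)
have : \forall u \near c^'+, h s t u < y by exact: (cvgr_lt _ (hrc c)).
move=> [e /= e0 he].
have : (ereal_inf (EFin @` upper_level s t y) < (c + e)%:E)%E.
  by rewrite infE lte_fin ltrDl.
move=> /ereal_inf_lt[_ [u yu <-]]; rewrite lte_fin => ue.
have cu : c <= u.
  by rewrite -lee_fin -infE; apply: ereal_inf_lbound; exists u.
have := yu; rewrite /upper_level/= leNgt => /negP; apply.
move: cu; rewrite le_eqVlt => /predU1P[<-//|cu].
by apply: he => //=; rewrite ltr_norml ltrBrDr ltrBlDr; apply/andP; split; lra.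
Qed.

Section ObservedEvents.
Variables (s s' : structure R K).
Hypothesis obsE : forall A, measurable A ->
  observed_dist s A = observed_dist s' A.

Lemma eq_observed_event t y (B : set (2.-tuple (K.-tuple R))) : measurable B ->
  law s ([set w | y <= Y s t w] `&` @covariates R K @^-1` B) =
  law s' ([set w | y <= Y s' t w] `&` @covariates R K @^-1` B).
Proof.
move=> mB; pose A : set (2.-tuple R * 2.-tuple (K.-tuple R)) :=
  [set o | y <= tnth o.1 t] `&` snd @^-1` B.
have AE s0 : [set w | y <= Y s0 t w] `&` @covariates R K @^-1` B =
    observables s0 @^-1` A.
  by apply/seteqP; split=> w; rewrite /A /= tnth_mktuple.
rewrite !AE; apply: obsE.
apply: measurableI.
  apply: measurable_set_le => //.
  exact: (measurableT_comp (measurable_tnth t) measurable_fst).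
by rewrite -[X in measurable X]setTI; exact: measurable_snd.
Qed.

Lemma eq_covariates_event B : measurable B ->
  law s (@covariates R K @^-1` B) = law s' (@covariates R K @^-1` B).
Proof.
move=> mB; apply: (obsE (A := snd @^-1` B)).
by rewrite -[X in measurable X]setTI; exact: measurable_snd.
Qed.

Lemma eq_Ysupp t : Ysupp s t = Ysupp s' t.
Proof.
have eqO O : open O ->
    pushforward (law s) (Y s t) O = pushforward (law s') (Y s' t) O.
  move=> oO; pose A : set (2.-tuple R * 2.-tuple (K.-tuple R)) :=
    (fun o => tnth o.1 t) @^-1` O.
  have AE s0 : Y s0 t @^-1` O = observables s0 @^-1` A.
    by apply/seteqP; split=> w; rewrite /A /= tnth_mktuple.
  rewrite /pushforward !AE; apply: obsE.
  rewrite -[X in measurable X]setTI.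
  apply: (measurableT_comp (measurable_tnth t) measurable_fst) => //.
  exact: open_measurable.
by apply/seteqP; split=> x sx O oO Ox; move: (sx O oO Ox); rewrite eqO.
Qed.

Lemma eq_Yunder t : Yunder s t = Yunder s' t.
Proof. by rewrite /Yunder /inf_Ysupp eq_Ysupp. Qed.

End ObservedEvents.

(** The fixed effect enters both thresholds additively and cancels, so their order depends on the
    covariates only. The periods are arbitrary, so that either can take the role of the more likely
    one. *)
Lemma A2_lt_event s t t' y y' c c' B : A2 s ->
  is_cutoff s t y c -> is_cutoff s t' y' c' -> measurable B ->
  B `<=` [set x | lin_index t (beta s) x - c < lin_index t' (beta s) x - c'] ->
  (0 < law s (@covariates R K @^-1` B))%E ->
  (law s ([set w | (y <= Y s t w)%R] `&` @covariates R K @^-1` B) <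
   law s ([set w | (y' <= Y s t' w)%R] `&` @covariates R K @^-1` B))%E.
Proof.
move=> [F [cdF cdfF suppF]] cut cut' mB Blt PB.
have mg u (a : R) : measurable_fun setT
    (fun z : R * 2.-tuple (K.-tuple R) => z.1 + lin_index u (beta s) z.2 - a).
  apply: measurable_funB => //; apply: measurable_funD.
    exact: measurable_fst.
  exact: (measurableT_comp (measurable_lin_index u _) measurable_snd).
have cdf z a : F t z `]-oo, a]%classic = F t' z `]-oo, a]%classic.
  have F1 u : F u z `]-oo, a]%classic = F period1 z `]-oo, a]%classic.
    have [->//|u0] := eqVneq u period1.
    by rewrite cdfF; congr (F _ _ _); apply/val_inj; case: u u0 => [[|[|]]].
  by rewrite F1 [RHS]F1.
rewrite (_ : [set w | y <= Y s t w] = [set w | U t w <=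
    (fun z => z.1 + lin_index t (beta s) z.2 - c) (alphaX w)]); last first.
  by apply/seteqP; split=> w /=; rewrite (cutoff_event _ cut).
rewrite (_ : [set w | y' <= Y s t' w] = [set w | U t' w <=
    (fun z => z.1 + lin_index t' (beta s) z.2 - c') (alphaX w)]); last first.
  by apply/seteqP; split=> w /=; rewrite (cutoff_event _ cut').
apply: (cond_dist_lt_event measurable_alphaX (measurable_U t) (measurable_U t')
  (mg t c) (mg t' c') (cdF t) (cdF t') cdf _ (D := snd @^-1` B)).
- by move=> z q r; exact: support_itv_gt0.
- by rewrite -[X in measurable X]setTI; exact: measurable_snd.
- by move=> z /Blt /=; rewrite -!addrA ltrD2l.
- exact: PB.
Qed.

(** If this set of covariates had positive probability, the two structures would rank the same two
    observable probabilities in strictly opposite orders. *)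
Lemma opposite_signs_null s s' t t' (y c c' : 'I_2 -> R) :
  A2 s -> A2 s' ->
  (forall A, measurable A -> observed_dist s A = observed_dist s' A) ->
  (forall u, is_cutoff s u (y u) (c u)) ->
  (forall u, is_cutoff s' u (y u) (c' u)) ->
  law s (@covariates R K @^-1`
    ([set x | lin_index t (beta s) x - c t < lin_index t' (beta s) x - c t'] `&`
     [set x | lin_index t' (beta s') x - c' t' <
              lin_index t (beta s') x - c' t])) = 0%E.
Proof.
move=> a2 a2' obsE cut cut'; set B := _ `&` _.
have mB : measurable B.
  by apply: measurableI; apply: measurable_set_lt; apply: measurable_funB => //;
    exact: measurable_lin_index.
apply/eqP; rewrite -[_ == _]negbK -measure_gt0; apply/negP => PB.
have lt1 : (law s ([set w | (y t <= Y s t w)%R] `&` @covariates R K @^-1` B) <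
   law s ([set w | (y t' <= Y s t' w)%R] `&` @covariates R K @^-1` B))%E.
  by apply: (A2_lt_event a2 (cut t) (cut t') mB) => // x [].
have lt2 : (law s' ([set w | (y t' <= Y s' t' w)%R] `&` @covariates R K @^-1` B) <
   law s' ([set w | (y t <= Y s' t w)%R] `&` @covariates R K @^-1` B))%E.
  apply: (A2_lt_event a2' (cut' t') (cut' t) mB) => [x []//|].
  by rewrite -(eq_covariates_event obsE mB).
move: lt1; rewrite !(eq_observed_event obsE _ _ mB) => /lt_trans/(_ lt2).
by rewrite ltxx.
Qed.

End Model.

(** * Signs of two affine functions on the line *)

Lemma affine_opposite_signs (R : realFieldType) (a b a' b' : R) : b != 0 ->
  (a * b' != a' * b) || (b * b' < 0) ->
  exists x, (b * x + a) * (b' * x + a') < 0.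
Proof.
move=> b0; have [aE /= bb'|d0 _] := eqVneq (a * b') (a' * b).
  (* In the proportional case, where the first form equals 1 the second equals [b' / b], which is
     negative. *)
  exists ((1 - a) / b).
  have -> : b * ((1 - a) / b) + a = 1 by field.
  rewrite mul1r.
  have -> : b' * ((1 - a) / b) + a' = (b * b') / b ^+ 2.
    have -> : b' * ((1 - a) / b) + a' = (b' - a * b' + a' * b) / b by field.
    by rewrite aE; field.
  by rewrite pmulr_llt0// invr_gt0 exprn_even_gt0.
(* Move away from the root -a/b of the first form, where the second one equals
   -d/b, by an amount small enough not to change the sign of the second. *)
set d := a * b' - a' * b; pose M := `|b * b'| + 1.
have M0 : 0 < M by rewrite ltr_wpDl.
have dn0 : d != 0 by rewrite subr_eq0.
exists (d / M - a / b).
have -> : (b * (d / M - a / b) + a) * (b' * (d / M - a / b) + a') =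
    d ^+ 2 * ((b * b' - M) / M ^+ 2).
  by rewrite /d; field; rewrite b0 gt_eqF.
rewrite pmulr_rlt0; last by rewrite exprn_even_gt0.
rewrite pmulr_llt0 ?invr_gt0 ?exprn_gt0// /M subr_lt0.
by rewrite (le_lt_trans (ler_norm _))// ltrDl.
Qed.

Lemma affine_gt0_near (R : realType) (a b x : R) : 0 < b * x + a ->
  exists2 e, 0 < e & forall u, `|u - x| < e -> 0 < b * u + a.
Proof.
move=> f0; have B0 : 0 < `|b| + 1 by rewrite ltr_wpDl.
(* The value at [x] divided by a Lipschitz constant; the added 1 keeps the divisor positive when [b]
   is 0. *)
exists ((b * x + a) / (`|b| + 1)); first by rewrite divr_gt0.
move=> u; rewrite ltr_pdivlMr// => ux.
have : `|b * (u - x)| <= `|u - x| * (`|b| + 1).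
  by rewrite normrM mulrC ler_wpM2l// lerDl.
move=> /le_lt_trans/(_ ux); rewrite ltr_norml => /andP[+ _].
by rewrite mulrBr; lra.
Qed.

(** Replaces a real witness by one of countably many rational intervals; signs at both endpoints
    control the affine forms in between. *)
Lemma affine_opposite_signs_near (R : realType) (a b a' b' x : R) :
  0 < b * x + a -> b' * x + a' < 0 -> exists q r : rat,
  [/\ q < r, 0 < b * ratr q + a, 0 < b * ratr r + a,
      b' * ratr q + a' < 0 & b' * ratr r + a' < 0].
Proof.
move=> /affine_gt0_near[e e0 he]; rewrite -oppr_gt0 opprD -mulNr.
move=> /affine_gt0_near[e' e'0 he']; pose m := Num.min e e'.
have m0 : 0 < m by rewrite lt_min e0.
have near u : `|u - x| < m -> 0 < b * u + a /\ b' * u + a' < 0.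
  rewrite lt_min => /andP[/he-> /he'].
  by rewrite mulNr -opprD oppr_gt0.
have /rat_in_itvoo[q] : x - m < x by rewrite ltrBlDr ltrDl.
rewrite in_itv/= => /andP[q1 q2].
have /rat_in_itvoo[r] : x < x + m by rewrite ltrDl.
rewrite in_itv/= => /andP[r1 r2].
have [|q3 q4] := near (ratr q); first by rewrite ltr_norml; apply/andP; lra.
have [|r3 r4] := near (ratr r); first by rewrite ltr_norml; apply/andP; lra.
by exists q, r; split => //; rewrite -(ltr_rat R) (lt_trans q2).
Qed.

(** * From null sign conflicts to proportional affine forms *)

Section DensityArgument.
Context d dS (T : measurableType d) (S : measurableType dS) (R : realType).
Variables (P : probability T R) (V : T -> R) (O : T -> S).
Variable kappa : R.-pker S ~> R.
Hypothesis mO : measurable_fun setT O.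
Hypothesis cd : cond_dist P V O kappa.
Hypothesis kappa_gt0 : forall q r : R, q < r ->
  {ae P, forall w, (0 < kappa (O w) `]q, r[%classic)%E}.

(** Otherwise a single rational interval would carry a sign conflict for a set of values of [O] of
    positive probability, and [V] would hit that interval with positive probability. *)
Let ae_not_opposite (a a' : S -> R) (b b' : R) :
  measurable_fun setT V -> measurable_fun setT a -> measurable_fun setT a' ->
  P [set w | 0 < b * V w + a (O w) /\ b' * V w + a' (O w) < 0] = 0%E ->
  {ae P, forall w,
    ~ exists x : R, 0 < b * x + a (O w) /\ b' * x + a' (O w) < 0}.
Proof.
move=> mV ma ma' null.
pose C (i : rat * rat) : set S := if i.1 < i.2 then
  ([set o | 0 < b * ratr i.1 + a o] `&` [set o | 0 < b * ratr i.2 + a o]) `&`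
  ([set o | b' * ratr i.1 + a' o < 0] `&` [set o | b' * ratr i.2 + a' o < 0])
  else set0.
have mC i : measurable (C i).
  rewrite /C; case: ifP => // _.
  by do 2?apply: measurableI; apply: measurable_set_lt => //;
    apply: measurable_funD.
have mOC i : measurable (O @^-1` C i).
  by rewrite -[X in measurable X]setTI; exact: mO.
apply: (negligibleS (A := \bigcup_i O @^-1` C i)).
  move=> w /= /notP[x [pos neg]].
  have [q [r [qr q1 r1 q2 r2]]] := affine_opposite_signs_near pos neg.
  by exists (q, r) => //; rewrite /C/= qr.
apply: negligible_bigcup_countType => -[q r]; apply/negligibleP => //.
apply/eqP; rewrite -[_ == _]negbK -measure_gt0; apply/negP.
have [qr|qr] := boolP (q < r); last first.
  by rewrite /C /= (negbTE qr) preimage_set0 measure0 ltxx.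
move=> /(cond_dist_gt0 mO cd (measurable_itv `]ratr q, ratr r[) (mC _)).
have qr' : (ratr q : R) < ratr r by rewrite ltr_rat.
move=> /(_ (kappa_gt0 qr')).
apply/negP; rewrite -leNgt -null; apply: le_measure; rewrite ?inE.
- apply: measurableI => //.
  by rewrite -[X in measurable X]setTI; apply: mV => //; exact: measurable_itv.
- apply: measurableI; apply: measurable_set_lt => //; apply: measurable_funD => //;
    try exact: measurable_funM; exact: (measurableT_comp _ mO).
- move=> w []; rewrite /C /= qr in_itv/= => /andP[qV Vr] [[q1 r1] [q2 r2]].
  (* [V w] is a convex combination of the endpoints, so each form keeps its sign there. *)
  have convex c e : (ratr r - ratr q) * (c * V w + e) =
    (ratr r - V w) * (c * ratr q + e) + (V w - ratr q) * (c * ratr r + e).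
    by ring.
  have rq0 : 0 < ratr r - ratr q :> R by rewrite subr_gt0.
  split.
    rewrite -(pmulr_rgt0 _ rq0) convex.
    by apply: addr_gt0; apply: mulr_gt0; rewrite ?subr_gt0.
  rewrite -(pmulr_rlt0 _ rq0) convex -[ltRHS]addr0.
  by apply: ltrD; rewrite pmulr_rlt0// subr_gt0.
Qed.

(** For almost every value of [O] the forms conflict nowhere on the whole line, in either order, and
    [affine_opposite_signs] applies by contraposition. *)
Lemma ae_proportional (a a' : S -> R) (b b' : R) : b != 0 ->
  measurable_fun setT V -> measurable_fun setT a -> measurable_fun setT a' ->
  P [set w | 0 < b * V w + a (O w) /\ b' * V w + a' (O w) < 0] = 0%E ->
  P [set w | 0 < b' * V w + a' (O w) /\ b * V w + a (O w) < 0] = 0%E ->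
  {ae P, forall w, a (O w) * b' = a' (O w) * b /\ 0 <= b * b'}.
Proof.
move=> b0 mV ma ma' /(ae_not_opposite mV ma ma') h1.
move=> /(ae_not_opposite mV ma' ma) h2.
apply: filterS (filterI h1 h2) => w [no1 no2].
have [/affine_opposite_signs|] :=
    boolP ((a (O w) * b' != a' (O w) * b) || (b * b' < 0)).
  move=> /(_ b0)[x]; set f := b * x + _; set f' := b' * x + _ => ff'.
  have [f0|f0|f0] := ltgtP f 0.
  - by case: no2; exists x; split=> //; rewrite -(nmulr_rlt0 _ f0).
  - by case: no1; exists x; split=> //; rewrite -(pmulr_rlt0 _ f0).
  - by move: ff'; rewrite f0 mul0r ltxx.
by rewrite negb_or negbK -leNgt => /andP[/eqP].
Qed.

End DensityArgument.

(** * Identification of the coefficient and the cutoff difference *)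

Section Covariates.
Variables (R : realType) (K : nat).
Implicit Types (s : structure R K) (t : 'I_2) (b : 'cV[R]_K) (g : R).

Lemma measurable_DeltaX (k : 'I_K) :
  measurable_fun setT (fun w : latent R K => DeltaX w 0 k).
Proof.
have mX t : measurable_fun setT (fun w : latent R K => tnth (X t w) k).
  apply: (measurableT_comp (measurable_tnth k)).
  exact: (measurableT_comp (measurable_tnth t) (@measurable_covariates R K)).
rewrite (_ : (fun w => _) = (fun w => tnth (X period2 w) k - tnth (X period1 w) k)).
  exact: measurable_funB.
by apply/funext => w; rewrite !mxE.
Qed.

Lemma measurable_DeltaX_others (k : 'I_K) :
  measurable_fun setT (@DeltaX_others R K k).
Proof.
apply/measurable_fun_tnthP => j.
rewrite (_ : _ \o _ = fun w => DeltaX w 0 (lift k j)).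
  exact: measurable_DeltaX.
by apply/funext => w /=; rewrite tnth_mktuple.
Qed.

Lemma W_mul b g (w : latent R K) :
  (W w *m col_mx b (const_mx g : 'cV_1)) 0 0 =
  lin_index period2 b (covariates w) - lin_index period1 b (covariates w) - g.
Proof.
rewrite /W mul_row_col /DeltaX mulmxBl !mxE big_ord1 !mxE mulN1r.
by rewrite /lin_index !mxE.
Qed.

(** Isolates the component that has a density as the affine variable; the other components form the
    intercept. *)
Lemma lin_index_diffE b g (w : latent R K) (k : 'I_K) :
  lin_index period2 b (covariates w) - lin_index period1 b (covariates w) - g =
  b k 0 * DeltaX_comp k w +
  (\sum_(j < K.-1) tnth (DeltaX_others k w) j * b (lift k j) 0 - g).
Proof.
rewrite addrA; congr (_ - _); rewrite /lin_index.
transitivity ((DeltaX w *m b) 0 0); first by rewrite /DeltaX mulmxBl !mxE.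
rewrite mxE (bigD1_ord k)//= mulrC; congr (_ + _).
by apply: eq_bigr => j _; rewrite tnth_mktuple.
Qed.

Lemma A3_i_interval_gt0 s : A3_i s -> exists k : 'I_K, beta s k 0 != 0 /\
  exists kappa : R.-pker (K.-1).-tuple R ~> R,
    cond_dist (law s) (DeltaX_comp k) (DeltaX_others k) kappa /\
    forall q r : R, q < r ->
      {ae law s, forall w, (0 < kappa (DeltaX_others k w) `]q, r[%classic)%E}.
Proof.
move=> [k [[kappa [cd dens]] bk]]; exists k; split=> //; exists kappa; split=> //.
move=> q r qr; apply: filterS dens => w [f [mf f0 ->]]; last exact: measurable_itv.
apply: integral_gt0 => //.
- by apply/measurable_EFinP; exact: measurable_funTS.
- by move=> x _; rewrite lee_fin ltW.
- by apply: aeW => x _; rewrite lte_fin.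
- have : (0 < (r - q)%:E)%E by rewrite lte_fin subr_gt0.
  by have := lebesgue_measure_itv `]q, r[; rewrite /= lte_fin qr -EFinB => <-.
Qed.

(** For nonzero [eta] the kernel of the linear form is a proper subspace. A support point outside it
    would give positive probability to the open set where the form is nonzero. *)
Lemma A3_ii_eq0 s (eta : 'cV[R]_(K + 1)) : A3_ii s ->
  {ae law s, forall w, (W w *m eta) 0 0 = 0} -> eta = 0.
Proof.
move=> a3 ae0.
pose L := linfun (mulmxr eta : {linear 'rV[R]_(K + 1) -> 'M[R]_1}).
have [full|nfull] := eqVneq (lker L) fullv.
  apply/matrixP => i j; rewrite ord1 [RHS]mxE.
  have : delta_mx 0 i \in lker L by rewrite full memvf.
  rewrite memv_ker lfunE/= -rowE => /eqP/matrixP/(_ 0 0).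
  by rewrite !mxE.
exfalso; apply: (a3 _ nfull) => v /= supp; rewrite memv_ker lfunE/=.
apply/negPn/negP => vn0.
have vn0' : (v *m eta) 0 0 != 0.
  by apply: contra vn0 => /eqP v0; apply/eqP/matrixP => i j; rewrite !ord1 v0 mxE.
pose O := [set u : 'rV[R]_(K + 1) | (u *m eta) 0 0 != 0].
have oO : open O.
  have -> : O = (fun u : 'rV[R]_(K + 1) => \sum_k u 0 k * eta k 0) @^-1`
      [set x : R | x != 0].
    by apply/seteqP; split=> u; rewrite /O /= mxE.
  apply: open_comp; last exact: open_neq.
  move=> u _; apply: continuous_big => [|k _]; first exact: add_continuous.
  move=> v'; have cvgk : u0 0 k @[u0 --> v'] --> v' 0 k by exact: coord_continuous.
  exact: (cvgM cvgk (cvg_cst _)).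
have := supp O oO vn0'; rewrite lt0e => /andP[/eqP + _]; apply.
suff mO : measurable (@W R K @^-1` O).
  apply/(negligibleP _ mO); apply: negligibleS ae0 => w /= /eqP; exact.
rewrite [X in measurable X](_ : _ = [set w | (W w *m eta) 0 0 != 0])//.
(* Separating the last entry of [eta] turns the form into an index difference minus a constant,
   which is measurable. *)
rewrite -[eta]vsubmxK.
have [g ->] : exists g, dsubmx eta = const_mx g :> 'cV_1.
  by exists (dsubmx eta 0 0); apply/matrixP => i j; rewrite !ord1 [RHS]mxE.
under eq_set do rewrite W_mul.
have mWm : measurable_fun setT (fun w : latent R K =>
    lin_index period2 (usubmx eta) (covariates w) -
    lin_index period1 (usubmx eta) (covariates w) - g).
  apply: measurable_funB => //; apply: measurable_funB;
    exact: (measurableT_comp (measurable_lin_index _ _) (@measurable_covariates R K)).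
rewrite -[X in measurable X]setTI.
by apply: (mWm _ [set x | x != 0]) => //; apply: open_measurable; exact: open_neq.
Qed.

Lemma euclidean_normZ (a : R) b : euclidean_norm b = 1 ->
  euclidean_norm (a *: b) = `|a|.
Proof.
rewrite /euclidean_norm => b1; under eq_bigr do rewrite mxE exprMn.
by rewrite -mulr_sumr sqrtrM ?sqr_ge0// b1 mulr1 sqrtr_sqr.
Qed.

(** Proportionality of the two affine forms and the rank condition give a vanishing combination of
    the two parameter vectors. The unit norms and the agreeing signs of the [k]-th coefficients then
    equate its two multipliers. *)
Lemma same_signs_eq s b' g g' : A3_i s -> A3_ii s ->
  euclidean_norm (beta s) = 1 -> euclidean_norm b' = 1 ->
  let V b g (w : latent R K) :=
    lin_index period2 b (covariates w) - lin_index period1 b (covariates w) -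
    g in
  law s [set w | 0 < V (beta s) g w /\ V b' g' w < 0] = 0%E ->
  law s [set w | 0 < V b' g' w /\ V (beta s) g w < 0] = 0%E ->
  beta s = b' /\ g = g'.
Proof.
move=> a3i a3ii b1 b1' V.
have [k [bk [kappa [cd kappa_gt0]]]] := A3_i_interval_gt0 a3i.
pose a b e (o : (K.-1).-tuple R) :=
  \sum_(j < K.-1) tnth o j * b (lift k j) 0 - e.
have VE b e w : V b e w = b k 0 * DeltaX_comp k w + a b e (DeltaX_others k w).
  exact: lin_index_diffE.
have ma (b : 'cV[R]_K) e : measurable_fun setT (a b e).
  apply: measurable_funB => //; apply: measurable_sum => j.
  by apply: measurable_funM => //; exact: measurable_tnth.
under eq_set do rewrite !VE.
move=> null1; under eq_set do rewrite !VE.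
move=> null2.
have prop := ae_proportional (measurable_DeltaX_others k) cd kappa_gt0 bk
  (measurable_DeltaX k) (ma _ _) (ma _ _) null1 null2.
(* This clause does not involve [w], so its failure would make the whole space null. *)
have bb'0 : 0 <= beta s k 0 * b' k 0.
  rewrite leNgt; apply/negP => bb'; have : law s setT = 0%E.
    apply/negligibleP => //; apply: negligibleS prop => w _ /= [_].
    by rewrite leNgt bb'.
  by rewrite probability_setT => -[] /eqP; rewrite oner_eq0.
pose x := b' k 0; pose y := beta s k 0.
pose p := x *: beta s - y *: b'; pose e := x * g - y * g'.
have : col_mx p (const_mx e : 'cV_1) = 0.
  apply: (A3_ii_eq0 a3ii); apply: filterS prop => w [eqa _].
  rewrite W_mul.
  have -> : lin_index period2 p (covariates w) -
      lin_index period1 p (covariates w) - e =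
      x * V (beta s) g w - y * V b' g' w.
    have idxE t : lin_index t p (covariates w) =
        x * lin_index t (beta s) (covariates w) -
        y * lin_index t b' (covariates w).
      by rewrite /lin_index /p mulmxBr -!scalemxAr !mxE.
    by rewrite !idxE /V /e; ring.
  rewrite !VE; move: (a (beta s) _ _) (a b' _ _) eqa => A A' eqa.
  (* The terms in [DeltaX_comp k] cancel and only the intercepts remain. *)
  by transitivity (A * x - A' * y); [rewrite /x /y; ring|rewrite eqa subrr].
move=> /eqP; rewrite col_mx_eq0 => /andP[/eqP p0 /eqP/matrixP/(_ 0 0)].
rewrite !mxE => e0.
have /eqP := congr1 (@euclidean_norm R K) (subr0_eq p0).
rewrite !euclidean_normZ// => /eqP nxy.
have xy : x = y.
  have [y0|y0|y0] := ltgtP y 0.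
  - move: nxy; rewrite (ltr0_norm y0) ler0_norm; first exact: oppr_inj.
    by rewrite -(nmulr_rge0 _ y0).
  - move: nxy; rewrite (gtr0_norm y0) ger0_norm//.
    by rewrite -(pmulr_rge0 _ y0).
  - by move: bk; rewrite -/y y0 eqxx.
have yn0 : y != 0 by [].
split.
  by apply: (scalerI yn0); rewrite -{1}xy; exact: subr0_eq.
by apply: (mulfI yn0); rewrite -{1}xy; exact: subr0_eq.
Qed.

End Covariates.

(** * Recovery of the transformations from their cutoffs *)

Section Cutoffs.
Variables (R : realType) (K : nat) (y0 : R).
Implicit Types (s : structure R K) (t : 'I_2) (y : R) (ys : 'I_2 -> R).

(** A non-constant monotone function takes two ordered values, and the larger one qualifies. It
    later serves as a pivot in period 2. *)
Lemma Ysupp_nonlowest s t : A1 s ->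
  exists2 y, Yunder s t y & upper_level s t y !=set0.
Proof.
move=> /(_ t)[supp hmono _ [x [x' hxx']]].
have [u [v huv]] : exists u v, h s t u < h s t v.
  by case: (ltgtP (h s t x) (h s t x')) hxx' => // ? _; [exists x, x'|exists x', x].
exists (h s t v); last by exists v; rewrite /upper_level/=.
split=> //; rewrite gt_eqF// (@le_lt_trans _ _ (h s t u)%:E) ?lte_fin//.
by apply: ereal_inf_lbound; exists (h s t u).
Qed.

(** A difference of extended reals is finite only if both terms are. *)
Lemma ginv_fin_num s ys : A4 s -> (forall t, Yunder s t (ys t)) ->
  forall t, ginv s t (ys t) \is a fin_num.
Proof.
move=> a4 yu t; have [_ /=] := a4 _ _ (yu period1) (yu period2).
rewrite /gamma fin_numB => /andP[f2 f1].
by case: (eqVneq t period1) => [->//|t1]; rewrite (_ : t = period2)//;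
  apply/val_inj; case: t t1 => [[|[|]]].
Qed.

(** The period is compared with itself at thresholds [c + 1] and [c]: the probability strictly
    exceeds another one, hence 0. *)
Lemma upper_level_event_gt0 s t y c : A2 s -> is_cutoff s t y c ->
  (0 < law s [set w | (y <= Y s t w)%R])%E.
Proof.
move=> a2 cut.
have [F [cdF _ suppF]] := a2.
have mg a : measurable_fun setT
    (fun z : R * 2.-tuple (K.-tuple R) => z.1 + lin_index t (beta s) z.2 - a).
  apply: measurable_funB => //; apply: measurable_funD.
    exact: measurable_fst.
  exact: (measurableT_comp (measurable_lin_index t _) measurable_snd).
have := cond_dist_lt_event (@measurable_alphaX R K) (@measurable_U R K t)
  (@measurable_U R K t) (mg (c + 1)) (mg c) (cdF t) (cdF t)
  (fun _ _ => erefl) (fun z q r => support_itv_gt0 (suppF t z)) measurableT.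
rewrite preimage_setT !setIT => lt_event.
rewrite (_ : [set w | y <= Y s t w] = [set w | U t w <=
    (fun z => z.1 + lin_index t (beta s) z.2 - c) (alphaX w)]); last first.
  by apply/seteqP; split=> w /=; rewrite (cutoff_event _ cut).
apply: le_lt_trans (lt_event _ _) => //.
  by move=> z _ /=; rewrite ltrD2l ltrN2 ltrDl.
by rewrite probability_setT.
Qed.

Section TwoStructures.
Variables s s' : structure R K.
Hypotheses (adm : admissible s y0) (adm' : admissible s' y0).
Hypothesis obsE : forall A, measurable A ->
  observed_dist s A = observed_dist s' A.

Lemma cutoff_diff_eq ys (c c' : 'I_2 -> R) :
  (forall t, Yunder s t (ys t)) ->
  (forall t, is_cutoff s t (ys t) (c t)) ->
  (forall t, is_cutoff s' t (ys t) (c' t)) ->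
  c period2 - c period1 = c' period2 - c' period1.
Proof.
move=> yu cut cut'.
have [_ [a2 [[a3i a3ii] [a4 _]]]] := adm; have [_ [a2' [_ [a4' _]]]] := adm'.
have yu' t : Yunder s' t (ys t) by rewrite -(eq_Yunder obsE).
have [b1 _] := a4 _ _ (yu period1) (yu period2).
have [b1' _] := a4' _ _ (yu' period1) (yu' period2).
apply: (proj2 (same_signs_eq a3i a3ii b1 b1' _ _)).
- rewrite -[RHS](opposite_signs_null period1 period2 a2 a2' obsE cut cut').
  congr (law s _); apply/seteqP; split=> w /= [h1 h2]; split; move: h1 h2; lra.
- rewrite -[RHS](opposite_signs_null period2 period1 a2 a2' obsE cut cut').
  congr (law s _); apply/seteqP; split=> w /= [h1 h2]; split; move: h1 h2; lra.
Qed.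

(** The event has positive probability under [s], hence under [s'], and any of its points yields an
    argument at which [h s' t] reaches [y]. *)
Lemma upper_level_transfer t y c : is_cutoff s t y c ->
  upper_level s' t y !=set0.
Proof.
have [_ [a2 _]] := adm => /(upper_level_event_gt0 a2).
have := eq_observed_event obsE t y measurableT.
rewrite !preimage_setT !setIT => -> pos.
have /set0P[w yw] : [set w | y <= Y s' t w] != set0.
  by apply: contraTneq pos => ->; rewrite measure0 ltxx.
by exists (Ystar s' t w).
Qed.

Lemma matched_cutoffs ys : (forall t, Yunder s t (ys t)) ->
  (forall t, upper_level s t (ys t) !=set0) ->
  exists c c' : 'I_2 -> R,
  [/\ forall t, ginv s t (ys t) = (c t)%:E /\ is_cutoff s t (ys t) (c t),
      forall t, ginv s' t (ys t) = (c' t)%:E /\ is_cutoff s' t (ys t) (c' t) &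
      c period2 - c period1 = c' period2 - c' period1].
Proof.
move=> yu ne; have [a1 [_ [_ [a4 _]]]] := adm.
have [a1' [_ [_ [a4' _]]]] := adm'.
have yu' t : Yunder s' t (ys t) by rewrite -(eq_Yunder obsE).
pose c t := fine (ginv s t (ys t)); pose c' t := fine (ginv s' t (ys t)).
have cE t : ginv s t (ys t) = (c t)%:E by rewrite fineK// ginv_fin_num.
have cE' t : ginv s' t (ys t) = (c' t)%:E by rewrite fineK// ginv_fin_num.
have cut t : is_cutoff s t (ys t) (c t) by apply: ginv_cutoff.
have cut' t : is_cutoff s' t (ys t) (c' t).
  by apply: ginv_cutoff => //; exact: (upper_level_transfer (cut t)).
by exists c, c'; split=> //; exact: cutoff_diff_eq cut cut'.
Qed.

(** Pairing a period 2 value with [y0], whose generalized inverse is 0 in both structures, equates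
    the period 2 cutoffs. A period 1 value is then paired with a period 2 value whose cutoff is
    already common. *)
Lemma common_cutoff t y : Yunder s t y -> upper_level s t y !=set0 ->
  exists c, is_cutoff s t y c /\ is_cutoff s' t y c.
Proof.
have [a1 [_ [_ [_ [yu0 ne0 g0]]]]] := adm.
have [_ [_ [_ [_ [_ _ g0']]]]] := adm'.
pose pair (v1 v2 : R) (t : 'I_2) := if t == period1 then v1 else v2.
have pairP (Q : 'I_2 -> R -> Prop) v1 v2 : Q period1 v1 -> Q period2 v2 ->
    forall t, Q t (pair v1 v2 t).
  move=> Q1 Q2 u; rewrite /pair; case: eqVneq => [->//|u1].
  by rewrite (_ : u = period2)//; apply/val_inj; case: u u1 => [[|[|]]].
have second z : Yunder s period2 z -> upper_level s period2 z !=set0 ->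
    exists c, [/\ ginv s period2 z = c%:E, ginv s' period2 z = c%:E,
      is_cutoff s period2 z c & is_cutoff s' period2 z c].
  move=> yz nez; have [c [c' [cP cP' dE]]] := matched_cutoffs
    (pairP _ _ _ yu0 yz)
    (pairP (fun t y => upper_level s t y !=set0) _ _ ne0 nez).
  have [] := cP period1; rewrite /pair eqxx g0 => -[c1] _.
  have [] := cP' period1; rewrite /pair eqxx g0' => -[c1'] _.
  move: dE; rewrite -c1 -c1' !subr0 => dE.
  have [] := cP period2; rewrite /pair/= => gz cutz.
  have [] := cP' period2; rewrite /pair/= -dE => gz' cutz'.
  by exists (c period2).
move=> yu ne; have [t1|t2] := eqVneq t period1; last first.
  have {t2} t2 : t = period2 by apply/val_inj; case: t t2 {yu ne} => [[|[|]]].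
  rewrite t2 in yu ne *; have [c [_ _ cut cut']] := second _ yu ne.
  by exists c.
rewrite t1 in yu ne *.
have [z yz nez] := Ysupp_nonlowest period2 a1.
have [e [gz gz' _ _]] := second _ yz nez.
have [c [c' [cP cP' dE]]] := matched_cutoffs (pairP _ _ _ yu yz)
  (pairP (fun t y => upper_level s t y !=set0) _ _ ne nez).
have [] := cP period2; rewrite /pair/= gz => -[c2] _.
have [] := cP' period2; rewrite /pair/= gz' => -[c2'] _.
move: dE; rewrite -c2 -c2' => /addrI/oppr_inj c1E.
exists (c period1); split; first by have [] := cP period1.
by rewrite c1E; have [] := cP' period1.
Qed.

(** If [h s t x] is the infimum of the support, it bounds [h s' t x], which lies in the same
    support. Otherwise the common cutoff at the level [h s t x] is at most [x]. *)
Lemma transformation_le t x : h s t x <= h s' t x.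
Proof.
have [a1 _] := adm; have [a1' _] := adm'.
have [supp _ _ _] := a1 t; have [supp' _ _ _] := a1' t.
have [infE|ninf] := eqVneq (h s t x)%:E (inf_Ysupp s t).
  rewrite -lee_fin infE; apply: ereal_inf_lbound.
  by exists (h s' t x) => //; rewrite (eq_Ysupp obsE).
have [||c [cut cut']] := @common_cutoff t (h s t x).
- by split.
- by exists x; rewrite /upper_level/=.
- by rewrite cut' -cut.
Qed.

End TwoStructures.
End Cutoffs.

Theorem theorem2 (R : realType) (K : nat) (y0 : R) :
  identified (fun s : structure R K => admissible s y0)
    (fun s : structure R K => (h s period1, h s period2)).
Proof.
move=> s s' adm adm' obsE.
(* Observational equivalence is symmetric, so exchanging the structures gives the reverse
   inequality. *)
have hE t : h s t = h s' t.
  apply/funext => x; apply/eqP; rewrite eq_le (transformation_le adm adm' obsE).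
  by rewrite (transformation_le adm' adm) => // A mA; rewrite obsE.
by rewrite !hE.
Qed.
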